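(* Let $\Gamma=(A_i,u_i)_{i=1,2}$ be a finite two-player game. The sequence of beliefs $(z_1(t),z_2(t))_{t\ge1}$ of a solution of a no-regret dynamics in class $\mathcal R$ is almost surely a payoff perturbed DFP trajectory.
   Context: **Game.** $\Gamma=(A_i,u_i)_{i=1,2}$: $A_i$ is the finite action set of player $i$, $A=A_1\times A_2$, $u_i:A\to\mathbb R$ is the payoff function, extended (multi)linearly to distributions. $-i$ denotes the opponent of $i$. $\Delta(S)$ is the set of probability distributions on a finite set $S$; pure actions are identified with vertices. For $z\in\Delta(A)$, $z_i\in\Delta(A_i)$ denotes its marginal for player $i$. **Regret.** For $z\in\Delta(A)$ and $k\in A_i$: $R_{i,k}(z)=u_i(k,z_{-i})-u_i(z)$, $R_i(z)=(R_{i,k}(z))_{k\in A_i}$, $R_{i,\max}(z)=\max_{k\in A_i}R_{i,k}(z)$. **Repeated play.** At each $t=1,2,\dots$ player $i$ chooses $a_i(t)\in A_i$; $a(t)=(a_1(t),a_2(t))$, $h(t)=(a(1),\dots,a(t))$. A strategy of player $i$ assigns to each history $h(t-1)$ a mixed action $q_i(t)\in\Delta(A_i)$, with weights $q_{i,k}(t)$; given $h(t-1)$, $a_1(t)$ and $a_2(t)$ are drawn independently from $q_1(t),q_2(t)$. The average correlated play is $z(t)=\frac1t\sum_{\tau=1}^t a(\tau)\in\Delta(A)$; its sequence of beliefs is the sequence of pairs of marginals $(z_1(t),z_2(t))\in\Delta(A_1)\times\Delta(A_2)$. Write $R_i(t)=R_i(z(t))$, $R_{i,\max}(t)=R_{i,\max}(z(t))$.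 **Potential.** A twice differentiable convex function $P_i:\mathbb R^{A_i}\to\mathbb R$ such that, with $\mathbb R_-^{A_i}$ the nonpositive orthant and $\nabla_k$ the partial derivative in coordinate $k$: (R1) $P_i\ge 0$ and $P_i(x)=0$ for all $x\in\mathbb R_-^{A_i}$; (R2) $\nabla P_i(\cdot)\ge 0$ and $\nabla P_i(x)\cdot x>0$ for all $x\notin\mathbb R_-^{A_i}$; (R3) if $x\notin\mathbb R_-^{A_i}$ and $x_k\le 0$, then $\nabla_kP_i(x)=0$. **Class $\mathcal R$.** The no-regret dynamics in class $\mathcal R$ are the processes $(z(t))_{t\ge1}$ generated when, for each $i=1,2$, there are a potential $P_i$ satisfying (R1)–(R3) and an action $c\in A_i$ such that (Q1) whenever $R_{i,\max}(t)>0$: $q_{i,k}(t+1)=\nabla_kP_i(R_i(t))\big/\sum_{s\in A_i}\nabla_sP_i(R_i(t))$ for all $k\in A_i$; (Q2) whenever $R_{i,\max}(t)\le 0$: $a_i(t+1)=c$. **Payoff perturbed DFP (discrete fictitious play) trajectory.** A sequence $x(t)=(x_1(t),x_2(t))_{t\ge1}$ in $\Delta(A_1)\times\Delta(A_2)$ for which there exists a positive sequence $(\varepsilon_t)$ converging to zero such that for all $t>1$, $x(t)-x(t-1)=\frac1t(a(t)-x(t-1))$, where $a(t)=(a_1(t),a_2(t))$ and, for $i=1,2$, $a_i(t)$ is a vertex of $\Delta(A_i)$ associated with a pure $\varepsilon_t$-best reply to $x_{-i}(t-1)$, i.e. $u_i(a_i(t),x_{-i}(t-1))\ge\max_{k\in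 A_i}u_i(k,x_{-i}(t-1))-\varepsilon_t$. *)

(* Defs.v *)
From mathcomp Require Import all_boot all_order all_algebra.
From mathcomp Require Import all_classical all_reals all_analysis.

Set Implicit Arguments.
Unset Strict Implicit.
Unset Printing Implicit Defensive.

Import Order.TTheory GRing.Theory Num.Theory numFieldNormedType.Exports.

Local Open Scope classical_set_scope.
Local Open Scope ring_scope.

Definition simplex (R : realType) (S : finType) : set {ffun S -> R} :=
  [set p | (forall s, 0 <= p s) /\ \sum_s p s = 1].
Arguments simplex : clear implicits.

Definition vertex (R : realType) (S : finType) (s0 : S) : {ffun S -> R} :=
  [ffun s => (s == s0)%:R].
Arguments vertex R {S} s0.

(* For a nonempty finite [S] the supremum is attained, hence a maximum; no
   inhabitant of [S] is needed to write it. *)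
Definition max_over (R : realType) (S : finType) (f : S -> R) : R :=
  sup (range f).

Inductive player := player1 | player2.

Definition opponent (i : player) : player :=
  match i with player1 => player2 | player2 => player1 end.

Section Game.
Variables (R : realType) (A : player -> finType).

Definition profile : finType := (A player1 * A player2)%type.

Variable u : player -> profile -> R.

Definition own (i : player) : profile -> A i :=
  match i with player1 => fun a => a.1 | player2 => fun a => a.2 end.

Definition join (i : player) : A i -> A (opponent i) -> profile :=
  match i with
  | player1 => fun k l => (k, l)
  | player2 => fun k l => (l, k)
  end.

Definition marginal (z : {ffun profile -> R}) (i : player) : {ffun A i -> R} :=
  [ffun k => \sum_(a : profile | own i a == k) z a].

Definition payoff (i : player) (z : {ffun profile -> R}) : R :=
  \sum_a z a * u i a.

Definition payoff_vs (i : player) (k : A i) (y : {ffun A (opponent i) -> R}) : R :=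
  \sum_l y l * u i (join k l).

Definition regret (i : player) (z : {ffun profile -> R}) (k : A i) : R :=
  payoff_vs k (marginal z (opponent i)) - payoff i z.

(* [R^{A_i}] is represented as ['rV[R]_#|A i|], which carries the normed space
   structure: the coordinate of the action [k] is [enum_rank k]. *)
Definition regret_vec (i : player) (z : {ffun profile -> R}) : 'rV[R]_#|A i| :=
  \row_j regret z (enum_val j).

Definition regret_max (i : player) (z : {ffun profile -> R}) : R :=
  max_over (@regret i z).

(* The head of the list is the first stage. *)
Definition history : Type := seq profile.

Definition average_play (h : history) : {ffun profile -> R} :=
  (size h)%:R^-1 *: \sum_(a <- h) vertex R a.

Definition strategy (i : player) : Type := history -> {ffun A i -> R}.

End Game.
Arguments marginal {R A} z i.
Arguments own {A} i a.
Arguments average_play R {A} h.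

Section Potential.
Variables (R : realType) (n : nat).

Definition pd (P : 'rV[R]_n -> R) (k : 'I_n) (x : 'rV[R]_n) : R :=
  'D_(delta_mx 0 k) P x.

Definition grad (P : 'rV[R]_n -> R) (x : 'rV[R]_n) : 'rV[R]_n :=
  \row_k pd P k x.

Definition twice_differentiable (P : 'rV[R]_n -> R) : Prop :=
  (forall x, differentiable P x) /\ (forall x, differentiable (grad P) x).

Definition nonpositive_orthant : set 'rV[R]_n :=
  [set x | forall k, x 0 k <= 0].

Record potential (P : 'rV[R]_n -> R) : Prop := {
  potential_diff : twice_differentiable P;
  potential_convex : convex_function setT P;
  potential_ge0 : forall x, 0 <= P x;
  potential_eq0 : forall x, nonpositive_orthant x -> P x = 0;
  potential_grad_ge0 : forall x k, 0 <= pd P k x;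
  potential_grad_gt0 : forall x, ~ nonpositive_orthant x ->
    0 < \sum_k pd P k x * x 0 k;
  potential_grad_eq0 : forall x k, ~ nonpositive_orthant x ->
    x 0 k <= 0 -> pd P k x = 0
}.

End Potential.

Section Dynamics.
Variables (R : realType) (A : player -> finType).
Variable u : player -> profile A -> R.

(* Playing [c] for sure is the same as the mixed action [vertex R c]. The
   conditions bear on stages [t + 1] with [t >= 1], i.e. on nonempty histories;
   the first mixed action is unconstrained. *)
Definition class_R_strategy (i : player) (q : strategy R A i) : Prop :=
  exists (P : 'rV[R]_#|A i| -> R) (c : A i),
    potential P /\
    forall h : history A, (0 < size h)%N ->
      let z := average_play R h in
      let r := regret_vec u i z in
      (0 < regret_max u i z -> forall k : A i,
         q h k = pd P (enum_rank k) r / \sum_(s : A i) pd P (enum_rank s) r) /\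
      (regret_max u i z <= 0 -> q h = vertex R c).

Variables (d : measure_display) (Omega : measurableType d).
Variable Pr : probability Omega R.

(* Stages are numbered from 1; the value [a 0] is never used. *)
Definition history_upto (a : nat -> Omega -> profile A) (t : nat) (w : Omega) :
    history A :=
  [seq a s w | s <- iota 1 t].

(* The second condition says that, given any history [h] of length [t], the
   actions of the two players at stage [t + 1] are independent with laws
   [q player1 h] and [q player2 h]. *)
Definition generated_by (q : forall i, strategy R A i)
    (a : nat -> Omega -> profile A) : Prop :=
  (forall t b, (0 < t)%N -> measurable (a t @^-1` [set b])) /\
  (forall t h b, size h = t ->
     Pr ([set w | history_upto a t w = h] `&` [set w | a t.+1 w = b]) =
     (Pr [set w | history_upto a t w = h] *
      (q player1 h b.1 * q player2 h b.2)%:E)%E).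

Definition no_regret_play (a : nat -> Omega -> profile A) : Prop :=
  exists q : forall i, strategy R A i,
    [/\ forall i h, simplex R (A i) (q i h),
        forall i, class_R_strategy (q i)
      & generated_by q a].

Definition beliefs (a : nat -> Omega -> profile A) (w : Omega) (t : nat)
    (i : player) : {ffun A i -> R} :=
  marginal (average_play R (history_upto a t w)) i.

End Dynamics.
Arguments beliefs R {A d Omega} a w t i.

(* The sequence [x] is indexed by [t >= 1]; [x 0] and [eps 0] are irrelevant. *)
Definition payoff_perturbed_DFP (R : realType) (A : player -> finType)
    (u : player -> profile A -> R) (x : nat -> forall i, {ffun A i -> R}) : Prop :=
  (forall t i, (0 < t)%N -> simplex R (A i) (x t i)) /\
  exists eps : nat -> R,
    [/\ forall t, 0 < eps t,
        eps @ \oo --> (0 : R)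
      & forall t, (1 < t)%N -> exists b : profile A, forall i,
          x t i - x t.-1 i = t%:R^-1 *: (vertex R (own i b) - x t.-1 i) /\
          max_over (fun k => payoff_vs u k (x t.-1 (opponent i))) - eps t
            <= payoff_vs u (own i b) (x t.-1 (opponent i))].

(* Main.v *)
Require Import Defs.
From mathcomp Require Import all_boot all_order all_algebra.
From mathcomp Require Import all_classical all_reals all_analysis.
From mathcomp Require Import zify ring lra.
Set Implicit Arguments.
Unset Strict Implicit.
Unset Printing Implicit Defensive.
Import Order.TTheory GRing.Theory Num.Theory numFieldNormedType.Exports.
Local Open Scope classical_set_scope.
Local Open Scope ring_scope.

(** Why the theorem holds.  The average play of stage [t] moves by a step of
    size [1 / t] towards the pair of actions played, so the recursion of a
    perturbed fictitious play holds for every path of play.  Only the loss of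
    player [i] at stage [t + 1] has to be controlled: it is the maximal regret
    minus the regret of the action played ([best_reply_gap]), and it has to
    vanish as [t] grows.

    At a nonempty history there are two regimes.  If the maximal regret is
    positive, an action has positive probability only if the partial derivative
    of the potential along it is positive, hence only if its regret is positive
    ([played_regret_gt0]); the loss is then at most the maximal regret.
    Otherwise the default action is played.  Playing an action does not change
    its own cumulative regret.  Therefore, once the maximal regret is positive
    it remains so, and as long as it has not become positive the cumulative
    regret of the default action is frozen at its value after the first stage
    ([default_regret]); its average regret is then of order [1 / t], and so is
    the loss.

    It remains to see that the positive part of the maximal regret vanishes
    almost surely.  As the potential is positive and nondecreasing off the
    nonpositive orthant ([potential_small]), it suffices that its value [p_t] at
    the regret vector of stage [t] converges to zero ([potential_vanishes]).  By
    convexity, and since the potential vanishes at the origin, its derivative at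
    [x] in the direction [x] is at least its value at [x]
    ([potential_le_slope]).  This makes the drift linear:
    [(t + 1) p_{t+1} <= t p_t + M_{t+1} + o(1)], where [M_{t+1}], the derivative
    in the direction of the regrets of stage [t + 1], is bounded and has mean
    zero given the past, because mixed actions are proportional to the gradient
    ([noise_mean0]).  Summing, [p_t] is at most the average of the
    [M_s] up to [o(1)] ([potential_approach]), and these averages converge to
    zero almost surely by a strong law of large numbers for bounded martingale
    differences ([martingale_slln]). *)

(** * Convex potentials *)

(** Uniform continuity on a compact set, in the sequential form in which it
    is applied to the gradient: only the first sequence has to stay in the
    compact set. *)
Lemma compact_unif_cvg {R : realType} {V W : normedModType R} (K : set V)
  (f : V -> W) (x y : nat -> V) : compact K -> continuous f ->
  (forall m, K (x m)) -> y m - x m @[m --> \oo] --> 0 ->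
  f (y m) - f (x m) @[m --> \oo] --> 0.
Proof.
move=> /compact_near_coveringP cK cf xK yx.
apply/cvgr0Pnorm_lt => e e0.
have : \forall m \near \oo, K `<=` (fun v => x m = v -> `|f (y m) - f v| < e).
  apply: cK => v Kv.
  have /nbhs_ballP[r /= r0 vr] : \forall w \near v, `|f v - f w| < e / 2.
    by move: (cf v) => /cvgrPdist_lt; apply; rewrite divr_gt0.
  near=> w m => /= xw.
  have vw : `|v - w| < r / 2.
    near: w; apply/nbhs_ballP; exists (r / 2); first by rewrite /= divr_gt0.
    by rewrite -ball_normE.
  have wy : `|y m - w| < r / 2.
    rewrite -xw; near: m; move/cvgr0Pnorm_lt : yx; apply.
    by rewrite divr_gt0.
  have fw : `|f v - f w| < e / 2.
    apply: vr; rewrite -ball_normE/=; apply: lt_trans vw _.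
    by rewrite ltr_pdivrMr// mulr_natr mulr2n ltrDl.
  have fy : `|f v - f (y m)| < e / 2.
    apply: vr; rewrite -ball_normE/= -(subrKA w).
    apply: le_lt_trans (ler_normD _ _) _; rewrite (distrC w).
    by rewrite (splitr r) ltrD.
  rewrite -(subrKA (f v)) (le_lt_trans (ler_normD _ _))// (splitr e) ltrD//.
  by rewrite distrC.
by apply: filterS => m /(_ _ (xK m)); exact.
Unshelve. all: by end_near. Qed.

Section ConvexPotential.
Context {R : realType} {n : nat}.
Implicit Types (P : 'rV[R]_n -> R) (x y v : 'rV[R]_n).

(** The derivative of [P] at [x] in the direction [v], as the scalar product of
    the gradient and [v]; see [slopeE]. *)
Definition slope P x v : R := \sum_k pd P k x * v 0 k.

Lemma slopeE P x v : differentiable P x -> 'D_v P x = slope P x v.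
Proof.
move=> dP; rewrite deriveE// {1}[v]row_sum_delta linear_sum.
by apply: eq_bigr => k _; rewrite linearZ/= -deriveE// mulrC.
Qed.

Lemma potential_conv P x y (t : R) : potential P -> 0 <= t <= 1 ->
  P (t *: x + (1 - t) *: y) <= t * P x + (1 - t) * P y.
Proof.
move=> hP /andP[t0 t1].
have it : Itv.spec (@Itv.num_sem R) (Itv.Real `[0%Z, 1%Z]) t.
  by apply/and3P; split; rewrite ?num_real//= bnd_simp.
have := @potential_convex _ _ _ hP (Itv.Def it) x y.
by rewrite !inE => /(_ I I); rewrite [X in _ <= X]convRE.
Qed.

(** A differentiable convex function lies above its tangents: by convexity the
    difference quotients from [x] towards [y] are at most [P y - P x]. *)
Lemma potential_slope_le P x y : potential P ->
  P x + slope P x (y - x) <= P y.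
Proof.
move=> hP; have dP := (potential_diff hP).1 x.
rewrite -slopeE// addrC -lerBrDr.
have dv : derivable P x (y - x) by exact: diff_derivable.
have cv : h^-1 *: (P (h *: (y - x) + x) - P x) @[h --> 0^'+] -->
    'D_(y - x) P x by exact: cvg_dnbhs_at_right dv.
rewrite -(cvg_lim _ cv)//; apply: limr_le.
  by apply/cvg_ex; eexists; exact: cv.
near=> h.
have h0 : 0 < h by near: h; exact: nbhs_right_gt.
have h1 : h < 1 by near: h; exact: nbhs_right_lt.
rewrite /= /GRing.scale/= ler_pdivrMl// lerBlDr.
have -> : h *: (y - x) + x = h *: y + (1 - h) *: x.
  by rewrite scalerBr scalerBl scale1r addrAC addrA.
apply: le_trans (potential_conv y x hP _) _; first by rewrite !ltW.
by rewrite le_eqVlt; apply/orP; left; apply/eqP; ring.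
Unshelve. all: by end_near. Qed.

(** The tangent at [x] lies below the potential at the origin, where it
    vanishes. *)
Lemma potential_le_slope P x : potential P -> P x <= slope P x x.
Proof.
move=> hP; have P0 : P 0 = 0 by apply: (potential_eq0 hP) => k; rewrite mxE.
have := potential_slope_le x 0 hP; rewrite sub0r P0.
have -> : slope P x (- x) = - slope P x x.
  by rewrite /slope -sumrN; apply: eq_bigr => k _; rewrite mxE mulrN.
by rewrite subr_le0.
Qed.

(** The tangent at half of [x] is nonnegative there and increases strictly in
    the direction [x]. *)
Lemma potential_gt0 P x : potential P -> ~ nonpositive_orthant x -> 0 < P x.
Proof.
move=> hP xN; pose y := 2^-1 *: x.
have yN : ~ nonpositive_orthant y.
  move=> yle; apply: xN => k; have := yle k.
  by rewrite mxE pmulr_rle0// invr_gt0.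
have := potential_slope_le y x hP.
have -> : x - y = y.
  by rewrite /y -{1}(scale1r x) -scalerBl; congr (_ *: _); field.
apply: lt_le_trans; apply: ltr_wpDl; first exact: potential_ge0.
exact: potential_grad_gt0 hP _ yN.
Qed.

Lemma potential_nondecreasing P x y : potential P ->
  (forall k, x 0 k <= y 0 k) -> P x <= P y.
Proof.
move=> hP xy; apply: le_trans (potential_slope_le x y hP).
rewrite lerDl sumr_ge0// => k _.
by rewrite mulr_ge0 ?(potential_grad_ge0 hP)// !mxE subr_ge0.
Qed.

(** A partial derivative is at most the increment of [P] over a unit step along
    its coordinate, and [P] is nondecreasing. *)
Lemma pd_bound P x k (B : R) : potential P -> (forall j, x 0 j <= B) ->
  pd P k x <= P (const_mx (B + 1)).
Proof.
move=> hP xB; pose y := x + delta_mx 0 k.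
have : P x + pd P k x <= P y.
  apply: le_trans (potential_slope_le x y hP); rewrite lerD2l.
  rewrite /slope (bigD1 k)//= big1 ?addr0 => [|j jk].
    by rewrite addrAC subrr add0r mxE !eqxx mulr1.
  by rewrite addrAC subrr add0r mxE (negbTE jk) andbF mulr0.
have := potential_ge0 hP x => Px0 le1.
have : P y <= P (const_mx (B + 1)).
  apply: (potential_nondecreasing hP) => j; rewrite !mxE lerD//.
  by rewrite eqxx/=; case: (_ == _).
lra.
Qed.

Definition box (B : R) : set 'rV[R]_n := [set x | forall k, `|x 0 k| <= B].

Lemma box_compact B : compact (box B).
Proof.
have -> : box B = [set x | forall k, `[- B, B]%classic (x ord0 k)].
  by apply/seteqP; split=> x /= + k => /(_ k); rewrite in_itv/= -ler_norml.
apply: (@rV_compact R n (fun=> `[- B, B]%classic)) => _; exact: segment_compact.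
Qed.

Lemma box_norm B x : 0 <= B -> box B x -> `|x| <= B.
Proof.
move=> B0 xB; rewrite [`|x|]mx_normrE; apply: bigmax_le => // -[i j] _.
by rewrite [i]ord1; exact: xB.
Qed.

Lemma coord_le_norm x k : `|x 0 k| <= `|x|.
Proof.
rewrite [leRHS]mx_normrE.
exact: (le_bigmax _ (fun ij : 'I_1 * 'I_n => `|x ij.1 ij.2|) (0, k)).
Qed.

(** Moving backwards along a coordinate stays in the orthant, where [P] is
    constant; the partial derivative is therefore the limit of zeros. *)
Lemma pd_eq0_orthant P x k : potential P -> nonpositive_orthant x ->
  pd P k x = 0.
Proof.
move=> hP xle; pose v : 'rV[R]_n := - delta_mx 0 k.
have dP := (potential_diff hP).1 x.
have -> : pd P k x = - 'D_v P x.
  by rewrite /pd /v !deriveE// linearN opprK.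
have dv : derivable P x v by exact: diff_derivable.
have cv : h^-1 *: (P (h *: v + x) - P x) @[h --> 0^'+] --> 'D_v P x.
  exact: cvg_dnbhs_at_right dv.
apply/eqP; rewrite oppr_eq0 -(cvg_lim _ cv)//; apply/eqP.
apply: cvg_lim => //; apply: cvg_near_cst; near=> h.
have h0 : 0 < h by near: h; exact: nbhs_right_gt.
rewrite !(potential_eq0 hP) ?subrr ?scaler0// => j.
rewrite !mxE mulrN addrC subr_le0 (le_trans (xle j))// mulr_ge0 ?ler0n// ltW.
Unshelve. all: by end_near. Qed.

(** Among the points of the box whose coordinate [k] is at least [e], the
    smallest one has all its other coordinates equal to [- B]; the potential is
    positive there, and it is nondecreasing. *)
Lemma potential_small P (B e : R) : potential P -> 0 < e ->
  exists2 c, 0 < c & forall x, box B x -> P x < c -> forall k, x 0 k < e.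
Proof.
move=> hP e0.
pose y (k : 'I_n) : 'rV[R]_n := \row_j (if j == k then e else - B).
have yP k : 0 < P (y k).
  apply: potential_gt0 => // /(_ k); rewrite mxE eqxx => ele.
  by move: (lt_le_trans e0 ele); rewrite ltxx.
exists (\big[Num.min/1]_k P (y k)).
  by apply: lt_bigmin.
move=> x xB xc k; rewrite ltNge; apply/negP => ex.
have : P (y k) <= P x.
  apply: (potential_nondecreasing hP) => j; rewrite mxE.
  case: eqP => [->//|_]; have := xB j; rewrite ler_norml; by case/andP.
rewrite leNgt => /negP; apply; apply: lt_le_trans xc _.
exact: bigmin_le.
Qed.

(** A deterministic approachability result: if [x t] is the average of the
    first [t] terms of [r], with bounded terms, then [t * P (x t)] is at most
    the sum of the slopes in the directions [r s], up to an error which is [o(t)]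
    because the gradient is uniformly continuous on a box. *)
Lemma potential_approach P (B : R) (x r : nat -> 'rV[R]_n) : potential P ->
  (forall t, box B (x t)) -> (forall t, box B (r t)) ->
  (forall t, x t.+1 - x t = t.+1%:R^-1 *: (r t - x t)) ->
  (\sum_(0 <= s < t) slope P (x s) (r s)) / t%:R @[t --> \oo] --> 0 ->
  P (x t) @[t --> \oo] --> 0.
Proof.
move=> hP xB rB xS noise.
have [n0|n_gt0] := posnP n.
  rewrite (_ : (fun t => _) = cst 0); first exact: cvg_cst.
  apply/funext => t /=; apply: (potential_eq0 hP) => k.
  by have := ltn_ord k; lia.
have B0 : 0 <= B by apply: le_trans (xB 0%N (Ordinal n_gt0)).
have boxB t k : `|(r t - x t) 0 k| <= 2 * B.
  rewrite !mxE (le_trans (ler_normB _ _))// mulr2n mulrDl mul1r.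
  exact: lerD (rB t k) (xB t k).
have boxN t : `|r t - x t| <= 2 * B by apply: box_norm => //; rewrite mulr_ge0.
have step0 : x t.+1 - x t @[t --> \oo] --> (0 : 'rV[R]_n).
  have cN : (2 * B) * t.+1%:R^-1 @[t --> \oo] --> 0.
    by rewrite -[X in _ --> X](mulr0 (2 * B)); exact: cvgM (cvg_cst _) cvg_harmonic.
  apply/norm_cvg0P; apply: squeeze_cvgr (cvg_cst 0) cN; near=> t.
  rewrite normr_ge0/= xS normrZ ger0_norm ?invr_ge0// mulrC.
  by rewrite ler_wpM2r ?invr_ge0.
pose err t := (2 * B *+ n) * `|grad P (x t.+1) - grad P (x t)|.
have err0 : err t @[t --> \oo] --> 0.
  rewrite -[X in _ --> X](mulr0 (2 * B *+ n)).
  apply: cvgM; first exact: cvg_cst.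
  apply/norm_cvg0P; apply: (@compact_unif_cvg _ _ _ (box B) (grad P) x (fun t => x t.+1)) => //.
    exact: box_compact.
  move=> y.
  exact/differentiable_continuous/(potential_diff hP).2.
have drift t : t%:R * P (x t) <=
    \sum_(0 <= s < t) slope P (x s) (r s) + \sum_(0 <= s < t) err s.
  elim: t => [|t IHt]; first by rewrite mul0r !big_nil addr0.
  rewrite !big_nat_recr//= addrACA.
  apply: le_trans (lerD IHt (lexx _)).
  (* The tangent is taken at the new point because it then bounds the increment
     of P from above; the price is the difference of the two gradients. *)
  have grad_step := potential_slope_le (x t.+1) (x t) hP.
  have le_slope := potential_le_slope (x t) hP.
  pose D k := grad P (x t.+1) 0 k - grad P (x t) 0 k.
  have slope_step : t.+1%:R * slope P (x t.+1) (x t - x t.+1) =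
      slope P (x t) (x t) - slope P (x t) (r t) - \sum_k D k * (r t - x t) 0 k.
    rewrite -opprB xS /slope mulr_sumr -!sumrB; apply: eq_bigr => k _.
    by rewrite /D !mxE; field; rewrite addrC natr1 pnatr_eq0.
  have errP : \sum_k D k * (r t - x t) 0 k <= err t.
    apply: le_trans (ler_norm _) _; rewrite (le_trans (ler_norm_sum _ _ _))//.
    apply: (@le_trans _ _ (\sum_(k < n) 2 * B * `|grad P (x t.+1) - grad P (x t)|)).
      apply: ler_sum => k _; rewrite normrM mulrC ler_pM//.
      have -> : D k = (grad P (x t.+1) - grad P (x t)) 0 k by rewrite /D !mxE.
      exact: coord_le_norm.
    by rewrite sumr_const card_ord /err [leRHS]mulrnAl.
  have : t.+1%:R * (P (x t.+1) + slope P (x t.+1) (x t - x t.+1)) <= t.+1%:R * P (x t).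
    by rewrite ler_wpM2l.
  rewrite mulrDr slope_step -natr1 mulrDl mul1r; lra.
have mean0 : (\sum_(0 <= s < t.+1) slope P (x s) (r s)) / t.+1%:R +
    arithmetic_mean err t @[t --> \oo] --> 0.
  rewrite -[X in _ --> X](addr0 0); apply: cvgD; last exact: cesaro.
  by move: noise; rewrite -cvg_shiftS.
rewrite -cvg_shiftS; apply: squeeze_cvgr (cvg_cst 0) mean0; near=> t.
rewrite /= potential_ge0//= /arithmetic_mean/= seriesEnat/= [X in _ + X]mulrC -mulrDl.
by rewrite ler_pdivlMr ?ltr0n// mulrC.
Unshelve. all: by end_near. Qed.

End ConvexPotential.


(** * A strong law of large numbers for bounded martingale differences *)

Section BlockTimes.
Context {R : realType}.

(** Quadratic times: sparse enough for Chebyshev bounds of order [1 / n] to be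
    summable, dense enough for a sum with bounded terms to change little
    between two of them.  The product form makes the series telescope. *)
Definition block_time (j : nat) : nat := (j.+1 * j.+2)%N.

Lemma block_time_cover n : (2 <= n)%N ->
  exists j, (block_time j <= n < block_time j.+1)%N.
Proof.
elim: n => // n IHn; rewrite leq_eqVlt => /orP[/eqP<-|/IHn[j]]; first by exists 0%N.
case/andP=> jn; rewrite leq_eqVlt => /orP[/eqP nj|nj]; last first.
  by exists j; rewrite leqW.
exists j.+1; rewrite nj leqnn/= /block_time; lia.
Qed.

(** Between two consecutive block times [s] changes by at most [C] times the
    length of the block, which is negligible with respect to its left end. *)
Lemma mean_cvg0_of_blocks (s : nat -> R) (C : R) : 0 <= C ->
  (forall n, `|s n.+1 - s n| <= C) ->
  (forall k, \forall j \near \oo,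
     `|s (block_time j)| < k.+1%:R^-1 * (block_time j)%:R) ->
  s n / n%:R @[n --> \oo] --> 0.
Proof.
move=> C0 sC sblock; apply/cvgr0Pnorm_lt => e e0.
have e20 : 0 < e / 2 by rewrite divr_gt0.
have [k ke] : exists k, k.+1%:R^-1 < e / 2.
  have [k _ /(_ k (leqnn k))] := near_infty_natSinv_lt (PosNum e20).
  by exists k.
have [J _ sJ] := sblock k.
have [J' J'e] : exists J' : nat, 2 * C / (e / 2) < J'%:R.
  exists (Num.bound (2 * C / (e / 2))); apply: archi_boundP.
  by apply: divr_ge0; [exact: mulr_ge0|exact: ltW].
pose m := maxn J J'.
near=> n.
have nm : (block_time m <= n)%N by near: n; exact: nbhs_infty_ge.
have n2 : (2 <= n)%N by apply: leq_trans nm; rewrite /block_time; lia.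
have [j /andP[jn nj]] := block_time_cover n2.
have mj : (m <= j)%N.
  rewrite leqNgt; apply/negP => jm; move: (leq_ltn_trans nm nj).
  by rewrite ltnNge leq_mul.
have fill p : `|s (p + block_time j)%N - s (block_time j)| <= p%:R * C.
  elim: p => [|p IHp]; first by rewrite subrr normr0 mul0r.
  rewrite -(subrKA (s (p + block_time j)%N)) (le_trans (ler_normD _ _))//.
  by rewrite -natr1 mulrDl mul1r addrC lerD// addSn.
have nR : (0 : R) < n%:R by rewrite ltr0n; lia.
have := fill (n - block_time j)%N; rewrite subnK// => sn.
have sj : `|s (block_time j)| < e / 2 * n%:R.
  apply: lt_le_trans (sJ j _) _; first by apply: leq_trans mj; exact: leq_maxl.
  by apply: ler_pM => //; [exact: ltW|rewrite ler_nat].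
have gap : (n - block_time j)%:R * C <= e / 2 * n%:R.
  have gapn : (n - block_time j <= 2 * j.+2)%N.
    by move: jn nj; rewrite /block_time; nia.
  have J'j : 2 * C <= e / 2 * j.+1%:R.
    rewrite -ler_pdivrMl// mulrC (le_trans (ltW J'e))// ler_nat.
    by apply: leq_trans (leqW mj); exact: leq_maxr.
  apply: (@le_trans _ _ (j.+2%:R * (e / 2 * j.+1%:R))).
    apply: (@le_trans _ _ (j.+2%:R * (2 * C))); last by rewrite ler_pM2l// ltr0n.
    by rewrite mulrA; apply: ler_wpM2r => //; rewrite -natrM ler_nat mulnC.
  by rewrite mulrCA ler_pM2l// -natrM ler_nat mulnC.
rewrite normf_div (ger0_norm (ltW nR)).
rewrite ltr_pdivrMr// -(subrK (s (block_time j)) (s n)).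
rewrite (le_lt_trans (ler_normD _ _))// (splitr e) mulrDl addrC ltr_leD//.
exact: le_trans sn gap.
Unshelve. all: by end_near. Qed.

End BlockTimes.

Section Past.
Context {T : Type}.
Implicit Types (act : nat -> T) (t : nat).

Definition past act t : seq T := [seq act s | s <- iota 1 t].

Lemma size_past act t : size (past act t) = t.
Proof. by rewrite size_map size_iota. Qed.

Lemma past_rcons act t : past act t.+1 = rcons (past act t) (act t.+1).
Proof. by rewrite /past -{1}(addn1 t) iotaD map_cat cats1 add1n. Qed.

End Past.

(** A process with values in a finite set; [Q h] is the law of the next value
    given that the past values are [h]. *)
Section AdaptedProcess.
Context {R : realType} {T : finType}.
Context {d : measure_display} {Omega : measurableType d}.
Variable Pr : probability Omega R.
Variable a : nat -> Omega -> T.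
Variable Q : seq T -> T -> R.

Hypothesis Q_ge0 : forall h b, 0 <= Q h b.
Hypothesis Q_sum1 : forall h, \sum_b Q h b = 1.
Hypothesis a_meas : forall t b, (0 < t)%N -> measurable (a t @^-1` [set b]).
Hypothesis a_law : forall t h b, size h = t ->
  Pr ([set w | past (a^~ w) t = h] `&` [set w | a t.+1 w = b]) =
  (Pr [set w | past (a^~ w) t = h] * (Q h b)%:E)%E.

Definition cylinder (h : seq T) : set Omega :=
  [set w | past (a^~ w) (size h) = h].

Lemma cylinder_rcons h b :
  cylinder (rcons h b) = cylinder h `&` [set w | a (size h).+1 w = b].
Proof.
rewrite /cylinder size_rcons; apply/seteqP; split=> w /=; rewrite past_rcons.
  by move/eqP; rewrite eqseq_rcons => /andP[/eqP-> /eqP->].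
by move=> [-> ->].
Qed.

Lemma measurable_cylinder h : measurable (cylinder h).
Proof.
elim/last_ind: h => [|h b IHh].
  by rewrite (_ : cylinder _ = setT)//; apply/seteqP; split.
rewrite cylinder_rcons; apply: measurableI => //.
exact: (@a_meas (size h).+1 b).
Qed.

Definition hist_mass (h : seq T) : R := fine (Pr (cylinder h)).

Lemma hist_massE h : (hist_mass h)%:E = Pr (cylinder h).
Proof. by rewrite fineK// fin_num_measure//; exact: measurable_cylinder. Qed.

Lemma hist_mass_ge0 h : 0 <= hist_mass h.
Proof. exact: fine_ge0. Qed.

Lemma hist_mass_nil : hist_mass [::] = 1.
Proof.
rewrite /hist_mass (_ : cylinder _ = setT) ?probability_setT//.
by apply/seteqP; split.
Qed.

Lemma hist_mass_rcons h b : hist_mass (rcons h b) = hist_mass h * Q h b.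
Proof.
apply: EFin_inj; rewrite hist_massE cylinder_rcons a_law// EFinM hist_massE.
by [].
Qed.

(** Expectations of functions of the past are finite sums over the
    histories of a given length; see [hist_mean]. *)
Fixpoint histories (n : nat) : seq (seq T) :=
  if n is m.+1 then [seq rcons h b | h <- histories m, b <- enum T]
  else [:: [::]].

Lemma mem_histories h : h \in histories (size h).
Proof.
elim/last_ind: h => //= h b IHh.
by rewrite size_rcons; apply: allpairs_f; rewrite ?mem_enum.
Qed.

Lemma size_histories n h : h \in histories n -> size h = n.
Proof.
elim: n h => [|n IHn] h /=; first by rewrite inE => /eqP->.
by case/allpairsP => -[h' b] /= [/IHn <- _ ->]; rewrite size_rcons.
Qed.

Definition hist_mean (n : nat) (g : seq T -> R) : R :=
  \sum_(h <- histories n) hist_mass h * g h.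

Lemma hist_meanS n g :
  hist_mean n.+1 g = hist_mean n (fun h => \sum_b Q h b * g (rcons h b)).
Proof.
rewrite /hist_mean/= big_allpairs_dep; apply: eq_bigr => h _.
rewrite big_enum mulr_sumr; apply: eq_bigr => b _.
by rewrite hist_mass_rcons mulrA.
Qed.

Lemma hist_mean_le n g1 g2 : (forall h, g1 h <= g2 h) ->
  hist_mean n g1 <= hist_mean n g2.
Proof. by move=> g12; apply: ler_sum => h _; rewrite ler_wpM2l ?hist_mass_ge0. Qed.

Lemma hist_mean1 n : hist_mean n (fun=> 1) = 1.
Proof.
elim: n => [|n IHn]; first by rewrite /hist_mean big_seq1 hist_mass_nil mulr1.
rewrite hist_meanS -[RHS]IHn; apply: eq_bigr => h _; congr (_ * _).
by under eq_bigr do rewrite mulr1; exact: Q_sum1.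
Qed.

(** An event about the past is the finite union of the cylinders of the
    histories satisfying it, hence measurable, and the probability of a union
    is at most the sum of the probabilities. *)
Lemma past_event n (p : pred (seq T)) :
  measurable [set w | p (past (a^~ w) n)] /\
  (Pr [set w | p (past (a^~ w) n)] <=
     (\sum_(h <- histories n | p h) hist_mass h)%:E)%E.
Proof.
have past_in w : past (a^~ w) n \in histories n.
  by rewrite -[X in histories X](size_past (a^~ w) n) mem_histories.
have -> : [set w | p (past (a^~ w) n)] =
    [set w | (past (a^~ w) n \in histories n) && p (past (a^~ w) n)].
  by apply/seteqP; split=> w /=; rewrite past_in.
have : {subset histories n <= histories n} by [].
elim: {1 3 4 5}(histories n) => [_|h l IHl hl].
  rewrite (_ : [set _ | _] = set0); last by apply/seteqP; split.
  by rewrite measure0 big_nil.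
have /IHl[ml Pl] : {subset l <= histories n}.
  by move=> k kl; apply: hl; rewrite inE kl orbT.
have sh : size h = n by apply/size_histories/hl/mem_head.
rewrite big_cons; case: ifPn => ph.
  have -> : [set w | (past (a^~ w) n \in h :: l) && p (past (a^~ w) n)] =
      cylinder h `|` [set w | (past (a^~ w) n \in l) && p (past (a^~ w) n)].
    rewrite /cylinder sh; apply/seteqP; split=> w /=; rewrite inE.
      by case/andP => /orP[/eqP|-> ->]; [left|right].
    by case=> [->|/andP[-> ->]]; rewrite ?eqxx ?orbT.
  split; first by apply: measurableU => //; exact: measurable_cylinder.
  rewrite (le_trans (measureU2 _ _ _))//; first exact: measurable_cylinder.
  by rewrite EFinD hist_massE leeD2l.
have -> : [set w | (past (a^~ w) n \in h :: l) && p (past (a^~ w) n)] =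
    [set w | (past (a^~ w) n \in l) && p (past (a^~ w) n)].
  apply/seteqP; split=> w /=; rewrite inE; last by case/andP=> -> ->; rewrite orbT.
  by case/andP => /orP[/eqP->|-> ->//]; rewrite (negbTE ph).
by split.
Qed.

(** Almost surely, no value of conditional probability zero ever occurs: at
    each stage the exceptional event is a finite union of null cylinders. *)
Lemma ae_charged : \forall w \ae Pr, forall t, 0 < Q (past (a^~ w) t) (a t.+1 w).
Proof.
apply/ae_foralln => t.
(* The last value of the history had conditional probability zero. *)
pose p (h : seq T) := if h is b :: h' then
  Q (belast b h') (last b h') == 0 else false.
have [mp Pp] := past_event t.+1 p.
exists [set w | p (past (a^~ w) t.+1)]; split=> //.
  apply/eqP; rewrite eq_le measure_ge0 andbT; apply: le_trans Pp _.
  rewrite big_seq_cond big1// => h /andP[/size_histories].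
  case/lastP: h => // h b _; rewrite hist_mass_rcons.
  by case: h => [|x h] /=; rewrite ?belast_rcons ?last_rcons => /eqP->; rewrite mulr0.
move=> w /negP nQ; rewrite /mkset past_rcons.
move: nQ; rewrite lt_def Q_ge0 andbT negbK.
by case: (past (a^~ w) t) => [|x h] //=; rewrite belast_rcons last_rcons.
Qed.

Variable f : seq T -> T -> R.

(** The sum of [f] along a history, by recursion on the reversed list since
    histories grow at their right end; see [hist_sum_past]. *)
Fixpoint rev_sum (l : seq T) : R :=
  if l is b :: l' then rev_sum l' + f (rev l') b else 0.

Definition hist_sum (h : seq T) : R := rev_sum (rev h).

Lemma hist_sum_rcons h b : hist_sum (rcons h b) = hist_sum h + f h b.
Proof. by rewrite /hist_sum rev_rcons /= revK. Qed.

Lemma hist_sum_past n w :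
  hist_sum (past (a^~ w) n) = \sum_(0 <= s < n) f (past (a^~ w) s) (a s.+1 w).
Proof.
elim: n => [|n IHn]; first by rewrite big_nil.
by rewrite past_rcons hist_sum_rcons IHn big_nat_recr.
Qed.

Variable C : R.
Hypothesis f_bound : forall h b, `|f h b| <= C.
Hypothesis f_mean0 : forall h, \sum_b Q h b * f h b = 0.

Let C_ge0 : 0 <= C.
Proof.
have [b _|T0] := pickP T; first exact: le_trans (normr_ge0 (f [::] b)) (f_bound _ _).
by have := Q_sum1 [::]; rewrite big_pred0// => /eqP; rewrite eq_sym oner_eq0.
Qed.

(** Martingale differences are orthogonal: the cross term of the square
    vanishes because [f] has mean zero given the past. *)
Lemma second_moment n : hist_mean n (fun h => hist_sum h ^+ 2) <= n%:R * C ^+ 2.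
Proof.
elim: n => [|n IHn].
  by rewrite /hist_mean big_seq1 /hist_sum/= expr0n mulr0 mul0r.
rewrite hist_meanS.
apply: (@le_trans _ _ (hist_mean n (fun h => hist_sum h ^+ 2 + C ^+ 2))).
  apply: hist_mean_le => h.
  have -> : \sum_b Q h b * hist_sum (rcons h b) ^+ 2 =
     hist_sum h ^+ 2 * (\sum_b Q h b) +
     hist_sum h *+ 2 * (\sum_b Q h b * f h b) + \sum_b Q h b * f h b ^+ 2.
    rewrite !mulr_sumr -!big_split/=; apply: eq_bigr => b _.
    by rewrite hist_sum_rcons; ring.
  rewrite Q_sum1 f_mean0 mulr1 mulr0 addr0 lerD2l.
  rewrite -[leRHS]mul1r -(Q_sum1 h) mulr_suml; apply: ler_sum => b _.
  by rewrite ler_wpM2l// -(real_normK (num_real (f h b))) ler_sqr ?nnegrE.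
have -> : hist_mean n (fun h => hist_sum h ^+ 2 + C ^+ 2) =
    hist_mean n (fun h => hist_sum h ^+ 2) + C ^+ 2 * hist_mean n (fun=> 1).
  rewrite /hist_mean mulr_sumr -big_split/=; apply: eq_bigr => h _; ring.
by rewrite hist_mean1 mulr1 -natr1 mulrDl mul1r lerD2r.
Qed.

Lemma chebyshev_sum (e : R) n : 0 < e -> (0 < n)%N ->
  (Pr [set w | (e * n%:R <= `|hist_sum (past (a^~ w) n)|)%R] <=
     (C ^+ 2 / e ^+ 2 / n%:R)%:E)%E.
Proof.
move=> e0 n0; have nR : 0 < n%:R :> R by rewrite ltr0n.
have [_ le1] := past_event n (fun h => e * n%:R <= `|hist_sum h|).
apply: le_trans le1 _; rewrite lee_fin.
have en0 : 0 < (e * n%:R) ^+ 2 by rewrite exprn_gt0// mulr_gt0.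
have -> : C ^+ 2 / e ^+ 2 / n%:R = n%:R * C ^+ 2 / (e * n%:R) ^+ 2.
  by field; rewrite !gt_eqF.
rewrite ler_pdivlMr//; apply: le_trans (second_moment n).
rewrite mulr_suml big_mkcond/=; apply: ler_sum => h _.
case: ifPn => [eh|_]; last by rewrite mulr_ge0 ?hist_mass_ge0 ?sqr_ge0.
rewrite ler_wpM2l ?hist_mass_ge0// -(real_normK (num_real (hist_sum h))).
by rewrite ler_sqr ?nnegrE// mulr_ge0 ?ltW.
Qed.

(** The Chebyshev bounds at block times are summable, so the Borel-Cantelli
    lemma applies. *)
Lemma ae_block_small (e : R) : 0 < e -> \forall w \ae Pr, \forall j \near \oo,
  `|hist_sum (past (a^~ w) (block_time j))| < e * (block_time j)%:R.
Proof.
move=> e0; pose E j := [set w | e * (block_time j)%:R <=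
  `|hist_sum (past (a^~ w) (block_time j))|].
have mE j : measurable (E j).
  by have [] := past_event (block_time j)
       (fun h => e * (block_time j)%:R <= `|hist_sum h|).
exists (lim_sup_set E); split.
- by apply: bigcapT_measurable => n; exact: bigcup_measurable.
- apply: lim_sup_set_cvg0 => //.
  pose c := C ^+ 2 / e ^+ 2.
  have c0 : 0 <= c by rewrite divr_ge0 ?sqr_ge0.
  apply: (@le_lt_trans _ _ c%:E); last by rewrite ltry.
  apply: lime_le; first exact: is_cvg_nneseries.
  apply: nearW => n.
  apply: (@le_trans _ _ (\sum_(0 <= j < n) (c * (j.+1%:R^-1 - j.+2%:R^-1))%:E)%E).
    apply: lee_sum => j _; apply: le_trans (chebyshev_sum e0 _) _ => //.
    rewrite lee_fin -/c ler_wpM2l// /block_time natrM.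
    rewrite le_eqVlt; apply/orP; left; apply/eqP.
    have j1 : j.+1%:R != 0 :> R by rewrite pnatr_eq0.
    have j2 : j.+1%:R + 1 != 0 :> R by rewrite natr1 pnatr_eq0.
    rewrite -(@natr1 R j.+1); set x := j.+1%:R in j1 j2 *.
    by field; exact/andP.
  rewrite sumEFin lee_fin -mulr_sumr -[leRHS]mulr1 ler_wpM2l//.
  have -> : \sum_(0 <= j < n) (j.+1%:R^-1 - j.+2%:R^-1) = 1 - n.+1%:R^-1 :> R.
    elim: n => [|n IHn]; first by rewrite big_nil invr1 subrr.
    by rewrite big_nat_recr//= IHn; ring.
  by rewrite gerBl invr_ge0 ler0n.
- move=> w /= nw N _; apply: contrapT => NE; apply: nw.
  exists N => // j Nj; rewrite ltNge; apply/negP => Ej.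
  by apply: NE; exists j.
Qed.

Lemma martingale_slln : \forall w \ae Pr,
  (\sum_(0 <= s < n) f (past (a^~ w) s) (a s.+1 w)) / n%:R @[n --> \oo] --> 0.
Proof.
have : \forall w \ae Pr, forall k, \forall j \near \oo,
    `|hist_sum (past (a^~ w) (block_time j))| < k.+1%:R^-1 * (block_time j)%:R.
  by apply/ae_foralln => k; apply: ae_block_small; rewrite invr_gt0.
apply: filterS => w sblock.
under eq_fun do rewrite -hist_sum_past.
apply: (mean_cvg0_of_blocks C_ge0) sblock => n.
by rewrite past_rcons hist_sum_rcons addrAC subrr add0r.
Qed.

End AdaptedProcess.

(** * Regrets along a history *)

Section MaxOver.
Context {R : realType} {S : finType}.
Implicit Types (f : S -> R) (s : S).

Lemma max_over_attained f s : exists k, max_over f = f k /\ forall l, f l <= f k.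
Proof.
have [k _ kmax] := arg_maxP f (erefl (xpredT s)).
exists k; split; last by move=> l; exact: kmax.
apply/eqP; rewrite eq_le; apply/andP; split.
  by apply: ge_sup; [exists (f s), s|move=> _ [l _ <-]; exact: kmax].
by apply: ub_le_sup; [exists (f k) => _ [l _ <-]; exact: kmax|exists k].
Qed.

Lemma le_max_over f s : f s <= max_over f.
Proof. by have [k [-> +]] := max_over_attained f s; exact. Qed.

End MaxOver.

Section Regret.
Context {R : realType} {A : player -> finType}.
Variable u : player -> profile A -> R.
Implicit Types (i : player) (h : history A) (b : profile A).

(** What the player would have gained in a single stage by playing [k] against
    the action actually played by the opponent. *)
Definition stage_regret i (b : profile A) (k : A i) : R :=
  u i (join k (own (opponent i) b)) - u i b.

Lemma join_own i b : join (own i b) (own (opponent i) b) = b.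
Proof. by case: i; case: b. Qed.

Lemma own_join i (k : A i) (l : A (opponent i)) : own i (join k l) = k.
Proof. by case: i k l. Qed.

Lemma own_opponent_join i (k : A i) (l : A (opponent i)) :
  own (opponent i) (join k l) = l.
Proof. by case: i k l. Qed.

Lemma sum_profile i (F : profile A -> R) :
  \sum_b F b = \sum_(k : A i) \sum_(l : A (opponent i)) F (join k l).
Proof.
rewrite pair_bigA (reindex (fun p : A i * A (opponent i) => join p.1 p.2))//=.
exists (fun b => (own i b, own (opponent i) b)) => [[k l] _|b _] /=.
  by rewrite own_join own_opponent_join.
exact: join_own.
Qed.

Lemma stage_regret_own i b : stage_regret b (own i b) = 0.
Proof. by rewrite /stage_regret join_own subrr. Qed.

Lemma regretE i (z : {ffun profile A -> R}) (k : A i) :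
  regret u z k = \sum_b z b * stage_regret b k.
Proof.
rewrite /regret /payoff /payoff_vs /stage_regret.
under [RHS]eq_bigr do rewrite mulrBr.
rewrite sumrB; congr (_ - _).
rewrite (partition_big (own (opponent i)) xpredT)//=; apply: eq_bigr => l _.
rewrite ffunE mulr_suml; apply: eq_bigr => b /eqP bl.
by rewrite bl.
Qed.

Lemma average_playE h b :
  average_play R h b = (size h)%:R^-1 * \sum_(c <- h) (b == c)%:R.
Proof.
rewrite /average_play ffunE sum_ffunE /GRing.scale/=; congr (_ * _).
by apply: eq_bigr => c _; rewrite ffunE.
Qed.

Lemma sum_average_play h (F : profile A -> R) :
  \sum_b average_play R h b * F b = (size h)%:R^-1 * \sum_(c <- h) F c.
Proof.
under eq_bigr do rewrite average_playE -mulrA mulr_suml.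
rewrite -mulr_sumr exchange_big/=; congr (_ * _); apply: eq_bigr => c _.
rewrite (bigD1 c)//= eqxx mul1r big1 ?addr0// => b /negbTE ->.
by rewrite mul0r.
Qed.

(** The regret is linear in the correlated distribution, so the regret of the
    average play is the average of the regrets of the stages. *)
Lemma regret_average i h (k : A i) :
  regret u (average_play R h) k = (size h)%:R^-1 * \sum_(b <- h) stage_regret b k.
Proof. by rewrite regretE sum_average_play. Qed.

Lemma regret_rcons i h b (k : A i) :
  (size h).+1%:R * regret u (average_play R (rcons h b)) k =
  (size h)%:R * regret u (average_play R h) k + stage_regret b k.
Proof.
rewrite !regret_average size_rcons -cats1 big_cat big_seq1 mulVKf ?pnatr_eq0//=.
by case: h => [|c h]; rewrite ?big_nil ?mul0r// mulVKf ?pnatr_eq0.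
Qed.

Definition stage_vec i b : 'rV[R]_#|A i| := \row_j stage_regret b (enum_val j).

Definition regret_bound i : R := \sum_b \sum_(k : A i) `|stage_regret b k|.

Lemma regret_bound_ge0 i : 0 <= regret_bound i.
Proof. by apply: sumr_ge0 => b _; apply: sumr_ge0. Qed.

Lemma stage_regret_bound i b (k : A i) : `|stage_regret b k| <= regret_bound i.
Proof.
rewrite /regret_bound (bigD1 b)//= (bigD1 k)//= -addrA lerDl addr_ge0//.
  exact: sumr_ge0.
by apply: sumr_ge0 => c _; apply: sumr_ge0.
Qed.

Lemma stage_vec_box i b : box (regret_bound i) (stage_vec i b).
Proof. by move=> k; rewrite mxE stage_regret_bound. Qed.

Lemma regret_vec_box i h :
  box (regret_bound i) (regret_vec u i (average_play R h)).
Proof.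
move=> j; rewrite mxE regret_average normrM ger0_norm ?invr_ge0//.
have [->|h0] := eqVneq (size h) 0%N.
  by rewrite invr0 mul0r regret_bound_ge0.
rewrite ler_pdivrMl ?ltr0n ?lt0n// (le_trans (ler_norm_sum _ _ _))//.
have -> : (size h)%:R * regret_bound i = \sum_(b <- h) regret_bound i.
  by rewrite big_const_seq count_predT -Monoid.iteropE mulr_natl.
by apply: ler_sum => b _; exact: stage_regret_bound.
Qed.

(** This covers the first stage too: the average of the empty history is zero
    because [0^-1 = 0]. *)
Lemma regret_vec_step i h b :
  regret_vec u i (average_play R (rcons h b)) - regret_vec u i (average_play R h) =
  (size h).+1%:R^-1 *: (stage_vec i b - regret_vec u i (average_play R h)).
Proof.
apply/rowP => j; rewrite !mxE.
apply: (mulfI (_ : (size h).+1%:R != 0)); first by rewrite pnatr_eq0.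
rewrite mulrBr regret_rcons mulVKf ?pnatr_eq0// -natr1; ring.
Qed.

Lemma regret_max_attained i z : A i -> exists k : A i,
  regret_max u i z = regret u z k /\ forall l : A i, regret u z l <= regret u z k.
Proof. exact: max_over_attained. Qed.

Lemma regret_max_gt0 i z (k : A i) : 0 < regret u z k -> 0 < regret_max u i z.
Proof. by move=> zk; apply: lt_le_trans zk (le_max_over _ _). Qed.

Lemma regret_maxN i z : A i -> 0 < regret_max u i z ->
  ~ nonpositive_orthant (regret_vec u i z).
Proof.
move=> k0; have [k [-> _]] := regret_max_attained z k0.
by move=> zk /(_ (enum_rank k)); rewrite mxE enum_rankK leNgt zk.
Qed.

Lemma regret_max_le0 i z : A i -> regret_max u i z <= 0 ->
  nonpositive_orthant (regret_vec u i z).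
Proof.
by move=> k0 zk j; rewrite mxE (le_trans (le_max_over _ _)).
Qed.

(** The regret of an action is its payoff against the belief minus a term that
    does not depend on the action. *)
Lemma best_reply_gap i z (k : A i) :
  max_over (fun l => payoff_vs u l (marginal z (opponent i))) -
    payoff_vs u k (marginal z (opponent i)) = regret_max u i z - regret u z k.
Proof.
have [l [-> lmax]] := max_over_attained
  (fun l => payoff_vs u l (marginal z (opponent i))) k.
have -> : regret_max u i z = regret u z l.
  apply/eqP; rewrite eq_le; apply/andP; split; last exact: le_max_over.
  have [m [-> _]] := regret_max_attained z k.
  by rewrite lerD2r; exact: lmax.
by rewrite /regret; ring.
Qed.

(** * No-regret play *)

Section Mixed.
Variable q : forall i, strategy R A i.
Hypothesis q_simplex : forall i h, simplex R (A i) (q i h).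

Definition profile_law h b : R := q player1 h b.1 * q player2 h b.2.

Lemma profile_lawE i h b :
  profile_law h b = q i h (own i b) * q (opponent i) h (own (opponent i) b).
Proof. by case: i => //=; rewrite mulrC. Qed.

Lemma profile_law_join i h (k : A i) (l : A (opponent i)) :
  profile_law h (join k l) = q i h k * q (opponent i) h l.
Proof. by rewrite (profile_lawE i) own_join own_opponent_join. Qed.

Lemma profile_law_ge0 h b : 0 <= profile_law h b.
Proof. by rewrite mulr_ge0//; apply: (q_simplex _ h).1. Qed.

Lemma profile_law_sum1 h : \sum_b profile_law h b = 1.
Proof.
rewrite (sum_profile player1).
under eq_bigr do (under eq_bigr do rewrite profile_law_join;
  rewrite -mulr_sumr (q_simplex _ h).2 mulr1).
exact: (q_simplex _ h).2.
Qed.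

(** A mixed action has no expected regret with respect to itself. *)
Lemma mean_stage_regret i h :
  \sum_(k : A i) q i h k * (\sum_b profile_law h b * stage_regret b k) = 0.
Proof.
pose V (k : A i) := \sum_(l : A (opponent i)) q (opponent i) h l * u i (join k l).
pose U := \sum_b profile_law h b * u i b.
have UE : U = \sum_k q i h k * V k.
  rewrite /U (sum_profile i); apply: eq_bigr => k _.
  rewrite mulr_sumr; apply: eq_bigr => l _.
  by rewrite profile_law_join mulrA.
have VE k : \sum_b profile_law h b * stage_regret b k = V k - U.
  under eq_bigr do rewrite /stage_regret mulrBr.
  rewrite sumrB; congr (_ - _).
  rewrite (sum_profile i) exchange_big/=; apply: eq_bigr => l _.
  under eq_bigr do rewrite profile_law_join own_opponent_join -mulrA.
  by rewrite -mulr_suml (q_simplex i h).2 mul1r.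
under eq_bigr do rewrite VE mulrBr.
by rewrite sumrB -mulr_suml (q_simplex i h).2 mul1r -UE subrr.
Qed.

Section Player.
Variables (i : player) (P : 'rV[R]_#|A i| -> R) (c : A i).
Hypothesis hP : potential P.
Hypothesis regret_matching : forall h : history A, (0 < size h)%N ->
  0 < regret_max u i (average_play R h) -> forall k : A i,
  q i h k = pd P (enum_rank k) (regret_vec u i (average_play R h)) /
    \sum_(s : A i) pd P (enum_rank s) (regret_vec u i (average_play R h)).
Hypothesis default_action : forall h : history A, (0 < size h)%N ->
  regret_max u i (average_play R h) <= 0 -> q i h = vertex R c.

(** The martingale difference that drives the potential: the slope at the
    current regret vector in the direction of the regrets of the next stage. *)
Definition noise h b : R :=
  slope P (regret_vec u i (average_play R h)) (stage_vec i b).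

Lemma noise_bound h b :
  `|noise h b| <= P (const_mx (regret_bound i + 1)) * regret_bound i *+ #|A i|.
Proof.
rewrite (le_trans (ler_norm_sum _ _ _))//.
apply: (@le_trans _ _ (\sum_(j < #|A i|)
    P (const_mx (regret_bound i + 1)) * regret_bound i)); last first.
  by rewrite sumr_const card_ord.
apply: ler_sum => j _.
rewrite normrM ger0_norm ?(potential_grad_ge0 hP)// ler_pM//.
- exact: (potential_grad_ge0 hP).
- apply: pd_bound => // k; apply: le_trans (ler_norm _) _.
  exact: regret_vec_box.
- exact: stage_vec_box.
Qed.

(** When the maximal regret is positive, the gradient is proportional to the
    mixed action, which has no expected regret with respect to itself; otherwise
    the gradient vanishes. *)
Lemma noise_mean0 h : \sum_b profile_law h b * noise h b = 0.
Proof.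
set x := regret_vec u i (average_play R h).
have noiseE b : noise h b =
    \sum_(k : A i) pd P (enum_rank k) x * stage_regret b k.
  rewrite /noise /slope -/x (reindex enum_rank) /=; last exact: onW_bij (enum_rank_bij _).
  by apply: eq_bigr => k _; rewrite mxE enum_rankK.
under eq_bigr do rewrite noiseE mulr_sumr.
rewrite exchange_big/=.
under eq_bigr => k _ do under eq_bigr => b _ do rewrite mulrCA.
under eq_bigr => k _ do rewrite -mulr_sumr.
have orthant0 : nonpositive_orthant x -> \sum_(k : A i)
    pd P (enum_rank k) x * (\sum_b profile_law h b * stage_regret b k) = 0.
  by move=> xle; apply: big1 => k _; rewrite pd_eq0_orthant// mul0r.
(* The empty history has the regret vector 0, since 0^-1 = 0. *)
have [h0|h_gt0] := posnP (size h).
  by apply: orthant0 => j; rewrite mxE regret_average h0 invr0 mul0r.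
have [/(regret_max_le0 c)//|xmax] := leP (regret_max u i (average_play R h)) 0.
set S := \sum_(s : A i) pd P (enum_rank s) x.
(* Should the sum of the nonnegative partial derivatives be zero, all of them
   would be. *)
have [S0|S0] := eqVneq S 0.
  apply: big1 => k _; suff -> : pd P (enum_rank k) x = 0 by rewrite mul0r.
  by apply: (psumr_eq0P _ S0) => // s _; exact: (potential_grad_ge0 hP).
have pdE k : pd P (enum_rank k) x = S * q i h k.
  by rewrite regret_matching// -/x -/S mulrC divfK.
under eq_bigr do rewrite pdE -mulrA.
by rewrite -mulr_sumr mean_stage_regret mulr0.
Qed.

(** A fixed path of play, with the two properties that hold almost surely. *)
Variable act : nat -> profile A.

Hypothesis charged : forall t, 0 < profile_law (past act t) (act t.+1).
Hypothesis noise_slln :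
  (\sum_(0 <= s < t) noise (past act s) (act s.+1)) / t%:R @[t --> \oo] --> 0.

Local Notation z t := (average_play R (past act t)).
Local Notation played t := (own i (act t.+1)).

Lemma played_charged t : 0 < q i (past act t) (played t).
Proof.
have := charged t; rewrite (profile_lawE i) lt_def.
case/andP; rewrite mulf_eq0 negb_or => /andP[q0 _] _.
by rewrite lt_def q0 (q_simplex i _).1.
Qed.

Lemma regret_step t (k : A i) :
  t.+1%:R * regret u (z t.+1) k = t%:R * regret u (z t) k + stage_regret (act t.+1) k.
Proof.
by have := regret_rcons (past act t) (act t.+1) k; rewrite size_past -past_rcons.
Qed.

Lemma potential_vanishes : P (regret_vec u i (z t)) @[t --> \oo] --> 0.
Proof.
apply: (@potential_approach _ _ P (regret_bound i) _ (fun t => stage_vec i (act t.+1))) => //.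
- by move=> t; exact: regret_vec_box.
- by move=> t; exact: stage_vec_box.
- by move=> t; rewrite past_rcons regret_vec_step size_past.
Qed.

Lemma played_regret_gt0 t : (0 < t)%N -> 0 < regret_max u i (z t) ->
  0 < regret u (z t) (played t).
Proof.
move=> t0 zmax; have := played_charged t.
rewrite regret_matching ?size_past// ltNge => /negP qN.
rewrite ltNge; apply/negP => zle; apply: qN.
rewrite (potential_grad_eq0 hP) ?mul0r//; first exact: regret_maxN.
by rewrite mxE enum_rankK.
Qed.

Lemma played_default t : (0 < t)%N -> regret_max u i (z t) <= 0 -> played t = c.
Proof.
move=> t0 zmax; have := played_charged t.
rewrite default_action ?size_past// ffunE.
by case: eqP => //; rewrite ltxx.
Qed.

(** Both alternatives persist: an action that is played keeps its cumulative
    regret, which is positive in the first case and that of the default action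
    in the second. *)
Lemma default_regret t : (0 < t)%N -> 0 < regret_max u i (z t) \/
  t%:R * regret u (z t) c = regret u (z 1%N) c.
Proof.
elim: t => // t IHt _; have [->|t0] := posnP t; first by right; rewrite mul1r.
have [zmax|zmax] := leP (regret_max u i (z t)) 0.
  right; rewrite regret_step -(played_default t0 zmax) stage_regret_own addr0.
  rewrite played_default//.
  by case: (IHt t0) => //; rewrite ltNge zmax.
left; apply: (@regret_max_gt0 _ _ (played t)).
rewrite -(pmulr_rgt0 _ (ltr0Sn R t)) regret_step stage_regret_own addr0.
by rewrite mulr_gt0 ?ltr0n// played_regret_gt0.
Qed.

Lemma gap_cvg0 :
  regret_max u i (z t) - regret u (z t) (played t) @[t --> \oo] --> 0.
Proof.
apply/cvgr0Pnorm_lt => e e0.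
have [r r0 rP] := potential_small (regret_bound i) hP e0.
near=> t.
have t0 : (0 < t)%N by near: t; exact: nbhs_infty_gt.
rewrite ger0_norm; last by rewrite subr_ge0 le_max_over.
have [zmax|zmax] := leP (regret_max u i (z t)) 0.
  case: (default_regret t0) => [|tc]; first by rewrite ltNge zmax.
  rewrite (played_default t0 zmax).
  have : `|regret u (z 1%N) c| < e * t%:R.
    rewrite mulrC -ltr_pdivrMr//; near: t; exact: nbhs_infty_gtr.
  rewrite -tc normrM ger0_norm// mulrC ltr_pM2r ?ltr0n// ltr_norml => /andP[+ _].
  lra.
have := played_regret_gt0 t0 zmax.
suff : regret_max u i (z t) < e by lra.
have [k [-> _]] := regret_max_attained (z t) c.
have := rP (regret_vec u i (z t)) (@regret_vec_box i (past act t)) _ (enum_rank k).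
rewrite mxE enum_rankK; apply; apply: le_lt_trans (ler_norm _) _.
by near: t; move/cvgr0Pnorm_lt : potential_vanishes; apply.
Unshelve. all: by end_near. Qed.

End Player.
End Mixed.
End Regret.

(** * Beliefs as a perturbed fictitious play *)

Lemma belief_simplex (R : realType) (A : player -> finType) (h : history A) i :
  (0 < size h)%N -> simplex R (A i) (marginal (average_play R h) i).
Proof.
move=> h0; split=> [k|].
  rewrite ffunE sumr_ge0// => b _.
  by rewrite average_playE mulr_ge0 ?invr_ge0// sumr_ge0// => c _; rewrite ler0n.
under eq_bigr do rewrite ffunE.
transitivity (\sum_b average_play R h b).
  by rewrite [RHS](partition_big (own i) xpredT).
under eq_bigr do rewrite -[average_play _ _ _]mulr1.
by rewrite (sum_average_play _ (fun=> 1)) big_const_seq count_predT -Monoid.iteropE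
  mulVf// pnatr_eq0 -lt0n.
Qed.

Lemma belief_step (R : realType) (A : player -> finType) (h : history A) b i :
  marginal (average_play R (rcons h b)) i - marginal (average_play R h) i =
  (size h).+1%:R^-1 *: (vertex R (own i b) - marginal (average_play R h) i).
Proof.
apply/ffunP => k; rewrite !ffunE.
have marginalE g : \sum_(a | own i a == k) average_play R g a =
    (size g)%:R^-1 * \sum_(c <- g) (own i c == k)%:R.
  rewrite big_mkcond -(sum_average_play _ (fun c => (own i c == k)%:R)).
  by apply: eq_bigr => c _; case: ifP; rewrite ?mulr1 ?mulr0.
rewrite !marginalE size_rcons -cats1 big_cat big_seq1/= eq_sym.
apply: (mulfI (_ : (size h).+1%:R != 0)); first by rewrite pnatr_eq0.
rewrite mulrBr !mulVKf ?pnatr_eq0//.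
have : (size h)%:R * ((size h)%:R^-1 * \sum_(c <- h) (own i c == k)%:R) =
    \sum_(c <- h) (own i c == k)%:R :> R.
  by case: h => [|c h]; rewrite ?big_nil ?mul0r// mulVKf ?pnatr_eq0.
set m := _^-1 * _ => <-; rewrite -natr1; ring.
Qed.

Theorem lemma2 (R : realType) (A : player -> finType)
  (u : player -> profile A -> R)
  (d : measure_display) (Omega : measurableType d) (Pr : probability Omega R)
  (a : nat -> Omega -> profile A)
  (Ha : no_regret_play u Pr a) :
  {ae Pr, forall w, payoff_perturbed_DFP u (beliefs R a w)}.
Proof.
have [q [q_simplex q_class [a_meas a_law]]] := Ha.
have law_ge0 := profile_law_ge0 q_simplex.
have law_sum1 := profile_law_sum1 q_simplex.
pose z w t := average_play R (history_upto a t w).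
have gap i : \forall w \ae Pr, regret_max u i (z w t) -
    regret u (z w t) (own i (a t.+1 w)) @[t --> \oo] --> 0.
  have [P [c [hP hq]]] := q_class i.
  have matching h h0 := (hq h h0).1; have default h h0 := (hq h h0).2.
  have charged := ae_charged law_ge0 a_meas a_law.
  have slln := martingale_slln law_ge0 law_sum1 a_meas a_law
    (noise_bound u hP) (noise_mean0 q_simplex c hP matching).
  apply: filterS2 charged slln => w wcharged wslln.
  exact: (gap_cvg0 q_simplex hP matching default wcharged wslln).
apply: filterS2 (gap player1) (gap player2) => w gap1 gap2.
have size_h t : size (history_upto a t w) = t by exact: size_past.
have h_rcons t : history_upto a t.+1 w = rcons (history_upto a t w) (a t.+1 w).
  exact: past_rcons.
split=> [t i t0|]; first by apply: belief_simplex; rewrite size_h.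
pose loss i t := max_over (fun k : A i =>
    payoff_vs u k (beliefs R a w t.-1 (opponent i))) -
  payoff_vs u (own i (a t w)) (beliefs R a w t.-1 (opponent i)).
have loss_ge0 i t : 0 <= loss i t.
  by rewrite subr_ge0; exact: (le_max_over (fun k : A i => payoff_vs u k _)).
have lossS i t : loss i t.+1 =
    regret_max u i (z w t) - regret u (z w t) (own i (a t.+1 w)).
  exact: best_reply_gap.
(* The losses may be zero, hence the term added to make the perturbation
   positive. *)
exists (fun t => t.+1%:R^-1 + (loss player1 t + loss player2 t)); split.
- by move=> t; rewrite ltr_pwDl ?invr_gt0// addr_ge0.
- rewrite -[X in _ --> X](addr0 0) -[X in _ + X](addr0 0).
  apply: cvgD; first exact: cvg_harmonic.
  by apply: cvgD; rewrite -cvg_shiftS /=; under eq_fun do rewrite lossS.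
- case=> // t t0; exists (a t.+1 w) => i; split.
    by rewrite /beliefs h_rcons belief_step size_h.
  suff : loss i t.+1 <= t.+2%:R^-1 + (loss player1 t.+1 + loss player2 t.+1).
    by rewrite lerBlDr -lerBlDl.
  have inv0 : 0 <= t.+2%:R^-1 :> R by rewrite invr_ge0.
  by rewrite ler_wpDl//; case: i; [rewrite ler_wpDr|rewrite ler_wpDl].
Qed.
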